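(* Let $R$ be a commutative ring with identity $1\neq 0$ such that $\overline{\Gamma}(R)\neq\Gamma(R)$. If $\overline{\Gamma}(R)$ is complemented, then every vertex of $\overline{\Gamma}(R)$ that is orthogonal in $\overline{\Gamma}(R)$ to the nonzero nilpotent element of $R$ is not an end of $\overline{\Gamma}(R)$.
   Context: $Z(R)$ is the set of zero-divisors of $R$ (including $0$) and $Z(R)^*=Z(R)\setminus\{0\}$. The zero-divisor graph $\Gamma(R)$ is the simple graph with vertex set $Z(R)^*$ in which two distinct vertices $x,y$ are adjacent if and only if $xy=0$. The extended zero-divisor graph $\overline{\Gamma}(R)$ is the simple graph with the same vertex set $Z(R)^*$ in which two distinct vertices $x,y$ are adjacent if and only if there exist positive integers $n,m$ with $x^ny^m=0$, $x^n\neq 0$ and $y^m\neq 0$. In a simple graph $G$, two vertices $u,v$ are orthogonal, written $u\perp v$, if they are adjacent and no vertex is adjacent to both of them. $G$ is complemented if for every vertex $v$ there is a vertex $u$ with $v\perp u$. An end is a vertex adjacent to exactly one vertex. Under the hypotheses of the statement, $R$ has exactly one nonzero nilpotent element, so ''the nonzero nilpotent element'' is meaningful (equivalently, read the statement for every nonzero nilpotent element). *)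

(* Defs.v *)
From mathcomp Require Import all_boot ssralg.

Set Implicit Arguments.
Unset Strict Implicit.
Unset Printing Implicit Defensive.

Import GRing.Theory.
Local Open Scope ring_scope.

(* The vertex set is a subset of an arbitrary, possibly infinite type T, so
   vertices and adjacency are Prop-valued. *)
Record sgraph (T : Type) := SGraph {
  vertex : T -> Prop;
  adj : T -> T -> Prop;
  adj_vertexl : forall x y, adj x y -> vertex x;
  adj_sym : forall x y, adj x y -> adj y x;
  adj_irrefl : forall x, ~ adj x x
}.

(* Equality of vertex sets and edge sets, without relying on propositional
   extensionality or proof irrelevance. *)
Definition sgraph_eq (T : Type) (G H : sgraph T) : Prop :=
  (forall x, vertex G x <-> vertex H x) /\
  (forall x y, adj G x y <-> adj H x y).

Definition orthogonal_in (T : Type) (G : sgraph T) (u v : T) : Prop :=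
  adj G u v /\ ~ (exists w, adj G w u /\ adj G w v).

Definition complemented (T : Type) (G : sgraph T) : Prop :=
  forall v, vertex G v -> exists u, vertex G u /\ orthogonal_in G v u.

Definition is_end (T : Type) (G : sgraph T) (v : T) : Prop :=
  vertex G v /\ exists! u, adj G v u.

Section ZeroDivisorGraphs.
Variable R : comNzRingType.
Implicit Types x y : R.

Definition zero_divisor x : Prop := exists2 y, y != 0 & x * y = 0.

Definition nilpotent_elt x : Prop := exists n : nat, x ^+ n = 0.

Definition nz_zero_divisor x : Prop := zero_divisor x /\ x != 0.

Definition zd_adj x y : Prop :=
  [/\ nz_zero_divisor x, nz_zero_divisor y, x != y & x * y = 0].

Definition ezd_adj x y : Prop :=
  [/\ nz_zero_divisor x, nz_zero_divisor y, x != y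
    & exists n m : nat, [/\ (0 < n)%N, (0 < m)%N,
        x ^+ n * y ^+ m = 0, x ^+ n != 0 & y ^+ m != 0]].

Fact zd_adj_vertexl x y : zd_adj x y -> nz_zero_divisor x.
Proof. by case. Qed.

Fact zd_adj_sym x y : zd_adj x y -> zd_adj y x.
Proof. by case=> hx hy ne e; split=> //; [rewrite eq_sym | rewrite mulrC]. Qed.

Fact zd_adj_irrefl x : ~ zd_adj x x.
Proof. by case=> _ _ /eqP. Qed.

Fact ezd_adj_vertexl x y : ezd_adj x y -> nz_zero_divisor x.
Proof. by case. Qed.

Fact ezd_adj_sym x y : ezd_adj x y -> ezd_adj y x.
Proof.
case=> hx hy ne [n [m [n0 m0 e xn ym]]]; split=> //; first by rewrite eq_sym.
by exists m, n; rewrite mulrC.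
Qed.

Fact ezd_adj_irrefl x : ~ ezd_adj x x.
Proof. by case=> _ _ /eqP. Qed.

Definition zd_graph : sgraph R :=
  SGraph zd_adj_vertexl zd_adj_sym zd_adj_irrefl.

Definition ezd_graph : sgraph R :=
  SGraph ezd_adj_vertexl ezd_adj_sym ezd_adj_irrefl.

End ZeroDivisorGraphs.

(* Main.v *)
Require Import Defs.
From mathcomp Require Import all_boot ssralg.

(** Suppose that [v] is an end, with sole neighbour the nilpotent [x].  Then
    whatever is annihilated by a nonzero power of [v] lies in [{0, v, x}].
    This forces [x^2 = 0], [R x] inside [{0, x, -x}], so that [ann x] is prime,
    and either [v = -x] or [v] is not nilpotent.  Since the two graphs differ
    and the extended one is complemented, there are [u] outside [ann x] and
    [w != 0] with [u w = 0].  If [v = -x] then [w] is a further neighbour of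
    [v].  Otherwise [u v] is adjacent to both [x] and [w], so a complement [c]
    of [u v] lies outside [ann x], and [(u v)^i c^j = 0] makes [u^i c^j], which
    is neither [0] nor [x], a further neighbour of [v]. *)

Set Implicit Arguments.
Unset Strict Implicit.
Unset Printing Implicit Defensive.

Import GRing.Theory.
Local Open Scope ring_scope.

Lemma last_nonzero_power (R : nzRingType) (r : R) (k : nat) :
  r ^+ k = 0 -> exists n, r ^+ n != 0 /\ r ^+ n.+1 = 0.
Proof.
elim: k => [|k IHk] rk; first by move/eqP: rk; rewrite expr0 oner_eq0.
by case: (eqVneq (r ^+ k) 0) => [/IHk //|nz]; exists k.
Qed.

Lemma ezd_adj_powl (R : comNzRingType) (a b : R) (n : nat) :
  nz_zero_divisor a -> a ^+ n != 0 -> b != 0 -> a != b ->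
  a ^+ n * b = 0 -> ezd_adj a b.
Proof.
move=> va an b0 ab anb; split=> //.
  by split=> //; exists (a ^+ n) => //; rewrite mulrC.
exists n, 1%N; rewrite expr1; split=> //.
(* Exponent zero would force [b = 0], so [n] is positive, as adjacency demands. *)
by case: n an anb => // _; rewrite expr0 mul1r => /eqP; rewrite (negPf b0).
Qed.

Lemma ezd_adj_mul0 (R : comNzRingType) (a b : R) :
  a != 0 -> b != 0 -> a != b -> a * b = 0 -> ezd_adj a b.
Proof.
move=> a0 b0 ab e; apply: (@ezd_adj_powl _ _ _ 1%N); rewrite ?expr1 //.
by split=> //; exists b.
Qed.

Definition ann_prime {R : comNzRingType} (x : R) : Prop :=
  forall r s, r * x != 0 -> s * x != 0 -> r * s * x != 0.

Lemma ann_prime_exp (R : comNzRingType) (x r : R) (n : nat) :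
  ann_prime x -> r * x != 0 -> r ^+ n * x != 0.
Proof.
move=> px rx; elim: n => [|n IHn]; last by rewrite exprS px.
by rewrite mul1r; apply: contraNneq rx => ->; rewrite mulr0.
Qed.

(** If [a] and [b] both kill [x], a complement [c] of [a] does not: otherwise [x], or [b] when
    [c = x], would be a common neighbour of [a] and [c]. By primality, powers of an element outside
    ann [x] stay outside. *)
Lemma annihilator_outside_ann (R : comNzRingType) (x a b : R) :
  complemented (ezd_graph R) -> x != 0 -> ann_prime x ->
  ezd_adj a b -> a * b != 0 -> exists u w, [/\ u * x != 0, w != 0 & u * w = 0].
Proof.
move=> hc x0 px eab ab.
case: (eab) => va vb neab [i [j [_ _ e ai bj]]].
have [ax|ax] := eqVneq (a * x) 0; last first.
  by exists (a ^+ i), (b ^+ j); rewrite ann_prime_exp.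
have [bx|bx] := eqVneq (b * x) 0; last first.
  by exists (b ^+ j), (a ^+ i); rewrite ann_prime_exp // mulrC.
have nax : a != x by apply: contraNneq ab => ->; rewrite mulrC bx.
have nbx : b != x by apply: contraNneq ab => ->; rewrite ax.
have [c [_ [eac nocommon]]] := hc a va.
have [cx|cx] := eqVneq (c * x) 0; last first.
  case: (eac) => _ vc neac [k [l [_ _ e' ak cl]]].
  by exists (c ^+ l), (a ^+ k); rewrite ann_prime_exp // mulrC.
have [_ [_ c0] _ _] := eac; case: nocommon.
have [ec|ncx] := eqVneq c x.
  exists b; split; first exact: ezd_adj_sym.
  by rewrite ec; apply: ezd_adj_mul0 => //; case: vb.
exists x; split; apply: ezd_adj_sym; apply: ezd_adj_mul0 => //; by case: va.
Qed.

Section EndAtNilpotent.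
Context {R : comNzRingType} {x v : R}.
Hypothesis x0 : x != 0.
Hypothesis adj_vx : ezd_adj v x.
Hypothesis end_v : forall y, ezd_adj v y -> y = x.

Let vert_v : nz_zero_divisor v. Proof. by case: adj_vx. Qed.
Let v0 : v != 0. Proof. by case: vert_v. Qed.

Lemma end_pow_ann (n : nat) (y : R) :
  v ^+ n != 0 -> v ^+ n * y = 0 -> [\/ y = 0, y = v | y = x].
Proof.
move=> vn e; have [->|y0] := eqVneq y 0; first by constructor 1.
have [->|yv] := eqVneq y v; first by constructor 2.
constructor 3; apply: end_v; apply: ezd_adj_powl vert_v vn y0 _ e.
by rewrite eq_sym.
Qed.

(* The last nonzero power of [v] kills [x + v]. *)
Lemma nilpotent_end_opp (k : nat) : v ^+ k = 0 -> v * x = 0 -> v = - x.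
Proof.
move=> /last_nonzero_power [[|n] [vn vSn]] vx.
  by move/eqP: vSn; rewrite expr1 (negPf v0).
have e : v ^+ n.+1 * (x + v) = 0.
  by rewrite mulrDr -exprSr vSn addr0 exprSr -mulrA vx mulr0.
case: (end_pow_ann vn e) => /eqP.
- by rewrite addrC addr_eq0 => /eqP.
- by rewrite -subr_eq0 addrK (negPf x0).
- by rewrite -subr_eq0 addrC addKr (negPf v0).
Qed.

(** The last nonzero power of [x] is killed by a power of [v], so it is [x] or [v]; in the latter
    case [v] is nilpotent and kills [x], whence [v = - x]. *)
Lemma nilpotent_nbr_sqr0 : nilpotent_elt x -> x * x = 0.
Proof.
case=> k /last_nonzero_power [K [xK xSK]].
have [_ _ _ [n [m [_ _ e vn xm]]]] := adj_vx.
have mK : (m <= K)%N.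
  rewrite leqNgt; apply: contraNN xm => /subnK <-.
  by rewrite exprD xSK mulr0.
have eK : v ^+ n * x ^+ K = 0.
  by rewrite -(subnKC mK) exprD mulrA e mul0r.
case: (end_pow_ann vn eK) => eqK.
- by move: xK; rewrite eqK eqxx.
- have vx : v * x = 0 by rewrite -eqK -exprSr.
  have vn0 : v ^+ K.+1 = 0.
    (* This leaves [0 ^+ K], which is [1] when [K = 0]; but then [xSK] reads [x ^+ 1 = 0]. *)
    rewrite -eqK exprAC xSK expr0n; case: (K) xSK => // /eqP.
    by rewrite expr1 (negPf x0).
  by apply: oppr_inj; rewrite -mulNr -(nilpotent_end_opp vn0 vx) oppr0.
- by rewrite -{2}eqK -exprS.
Qed.

Hypothesis x2 : x * x = 0.

Lemma sqr0_nbr_pow_ann : exists n, v ^+ n != 0 /\ v ^+ n * x = 0.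
Proof.
have [_ _ _ [n [[|[|m]] [_ m0 e vn xm]]]] := adj_vx => //.
  by exists n; rewrite -[x in _ * x]expr1.
by move: xm; rewrite 2!exprS mulrA x2 mul0r eqxx.
Qed.

(** A power of [v] kills [x], hence [r * x]; if [r * x = v], then [v] has square zero and kills
    [x]. *)
Lemma multiple_of_nbr (r : R) : [\/ r * x = 0, r * x = x | r * x = - x].
Proof.
have [n [vn e]] := sqr0_nbr_pow_ann.
have er : v ^+ n * (r * x) = 0 by rewrite mulrCA e mulr0.
case: (end_pow_ann vn er) => erx; [by constructor 1| |by constructor 2].
constructor 3; rewrite erx; apply: (@nilpotent_end_opp 2).
  by rewrite -erx expr2 mulrACA x2 mulr0.
by rewrite -erx -mulrA x2 mulr0.
Qed.

(** Elements outside ann [x] act on [x] as signs. *)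
Lemma nbr_ann_prime : ann_prime x.
Proof.
move=> r s rx sx; rewrite (mulrC r) -mulrA.
case: (multiple_of_nbr r) => e; first by rewrite e eqxx in rx.
  by rewrite e.
by rewrite e mulrN oppr_eq0.
Qed.

Lemma end_mul_nbr : v * x = 0.
Proof.
have [n [_ e]] := sqr0_nbr_pow_ann.
by apply/eqP; apply: contraPT e => /(ann_prime_exp n nbr_ann_prime)/eqP.
Qed.

Lemma complemented_end_absurd (u w : R) :
  complemented (ezd_graph R) -> u * x != 0 -> w != 0 -> u * w = 0 -> False.
Proof.
move=> hc ux w0 uw.
have px := nbr_ann_prime; have vx := end_mul_nbr.
have wx : w * x = 0.
  apply/eqP; apply: contraT => wx.
  by have := px _ _ ux wx; rewrite uw mul0r eqxx.
have nwx : w != x by apply: contraNneq ux => <-; rewrite uw.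
have [ev|nev] := eqVneq v (- x).
  have e1 : v ^+ 1 * w = 0 by rewrite expr1 ev mulNr mulrC wx oppr0.
  have [||] := end_pow_ann (v0 : v ^+ 1 != 0) e1; try exact/eqP.
  by move=> ewv; move/eqP: uw; rewrite ewv ev mulrN oppr_eq0 (negPf ux).
have vN k : v ^+ k != 0.
  by apply: contraNneq nev => vk; apply/eqP; apply: nilpotent_end_opp vk vx.
have killed n y : v ^+ n * y = 0 -> y * x = 0.
  by case/(end_pow_ann (vN n)) => ->; rewrite ?mul0r.
(* Otherwise [killed] would put [u ^+ n] in ann [x], against primality. *)
have qN n : (u * v) ^+ n != 0.
  apply: contraNneq (ann_prime_exp n px ux).
  by rewrite exprMn mulrC => /killed ->.
have q0 : u * v != 0 := qN 1.
have qx : u * v * x = 0 by rewrite -mulrA vx mulr0.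
have qw : u * v * w = 0 by rewrite mulrAC uw mul0r.
(* Equality with [x] or [w] would make the square of [u * v] vanish. *)
have nqx : u * v != x by apply: contraNneq (qN 2) => e; rewrite e expr2 x2.
have nqw : u * v != w by apply: contraNneq (qN 2) => e; rewrite expr2 {2}e qw.
have vq : nz_zero_divisor (u * v) by split=> //; exists w.
have [c [_ [eqc nocommon]]] := hc _ vq.
have [_ [_ c0] _ [i [j [_ _ e _ _]]]] := eqc.
have [cx|cx] := eqVneq (c * x) 0; last first.
  (* [v ^+ i] kills [u ^+ i * c ^+ j], which thus lies in ann [x], against primality. *)
  have := px _ _ (ann_prime_exp i px ux) (ann_prime_exp j px cx).
  by rewrite (killed i) ?eqxx // mulrA (mulrC (v ^+ i)) -exprMn.
(* The common neighbour is [x], replaced by [w] when [c = x]. *)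
apply: nocommon; have [->|ncx] := eqVneq c x.
  exists w; split; last exact: ezd_adj_mul0.
  by apply: ezd_adj_sym; apply: ezd_adj_mul0.
by exists x; split; apply: ezd_adj_sym; apply: ezd_adj_mul0.
Qed.

End EndAtNilpotent.

Theorem corollary4p5 (R : comNzRingType)
    (hne : ~ sgraph_eq (ezd_graph R) (zd_graph R))
    (hcompl : complemented (ezd_graph R))
    (x : R) (hx0 : x != 0) (hxnil : nilpotent_elt x)
    (v : R) (hv : vertex (ezd_graph R) v) (hvx : orthogonal_in (ezd_graph R) v x) :
  ~ is_end (ezd_graph R) v.
Proof.
case: hvx => /= adj_vx _ [_ [y [_ uniq_y]]].
have end_v z : ezd_adj v z -> z = x.
  by move=> /uniq_y <-; exact: uniq_y.
have x2 := nilpotent_nbr_sqr0 hx0 adj_vx end_v hxnil.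
have px := nbr_ann_prime hx0 adj_vx end_v x2.
apply: hne; split=> [//|a b /=]; split=> [eab|[[za a0] [zb b0] ab e]]; last first.
  exact: ezd_adj_mul0.
(* The vertex sets agree, so only an extended edge with [a * b != 0] could separate the graphs. *)
have [va vb ab _] := eab; split=> //; apply/eqP; apply: contraT => nab.
have [u [w [ux w0 uw]]] := annihilator_outside_ann hcompl hx0 px eab nab.
by case: (complemented_end_absurd hx0 adj_vx end_v x2 hcompl ux w0 uw).
Qed.
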